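(* Let $r\ge1$ and suppose that a symmetric Markov semigroup $(T_t)_{t\ge0}$ on a finite probability space $(\Omega,\mu)$ satisfies $r$-logSob with constant $C>0$. Then for all real $q<p<1$, every $f\in\mathcal{H}_{(0,\infty)}$ and all $t\ge\frac{C}{4}\log\frac{1-q}{1-p}$ we have $$\|T_tf\|_q\ge\|f\|_p.$$
   Context: Setting: $(\Omega,\mu)$ is a finite probability space with $\mu\{\omega\}>0$ for all $\omega\in\Omega$; $\mathbb{E}f=\int_\Omega f\,d\mu$; $\mathcal{H}$ is the space of real-valued functions on $\Omega$ and $\mathcal{H}_{(0,\infty)}$ the set of strictly positive functions. A generator is a linear operator $L:\mathcal{H}\to\mathcal{H}$ such that: $L1=0$; $\mathbb{E}[fLg]=\mathbb{E}[gLf]$ for all $f,g\in\mathcal{H}$; $\mathbb{E}[fLf]\ge 0$ for all $f\in\mathcal{H}$; and whenever $f\in\mathcal{H}$ and $\omega\in\Omega$ satisfy $f\le f(\omega)$ on $\Omega$, then $(Lf)(\omega)\ge 0$. The symmetric Markov semigroup generated by $L$ is $T_t=e^{-tL}$, $t\ge0$; the Dirichlet form is $\mathcal{E}(f,g)=\mathbb{E}[fLg]$. For $f\in\mathcal{H}_{(0,\infty)}$: $\|f\|_p=(\mathbb{E}f^p)^{1/p}$ for real $p\ne0$, and $\|f\|_0=\exp(\mathbb{E}\log f)$. For $f>0$, $Ent(f)=\mathbb{E}(f\log f)-\mathbb{E}f\cdot\log\mathbb{E}f$. For $r>1$, $r$-logSob is satisfied with constant $C>0$ if $Ent(f^r)\le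 \frac{Cr^2}{4(r-1)}\mathcal{E}(f^{r-1},f)$ for every $f\in\mathcal{H}_{(0,\infty)}$; $1$-logSob is satisfied with constant $C>0$ if $Ent(f)\le\frac{C}{4}\mathcal{E}(f,\log f)$ for every $f\in\mathcal{H}_{(0,\infty)}$. *)

(* Defs.v *)
From HB Require Import structures.
From mathcomp Require Import all_boot all_order all_algebra.
From mathcomp Require Import all_classical all_reals all_analysis.
Set Implicit Arguments.
Unset Strict Implicit.
Unset Printing Implicit Defensive.
Import Order.TTheory GRing.Theory Num.Theory.
Import numFieldNormedType.Exports.
Local Open Scope ring_scope.

Section FiniteMarkov.
Context {R : realType} {Omega : finType}.

Record prob_weights (mu : Omega -> R) : Prop := ProbWeights {
  prob_weights_gt0 : forall w, 0 < mu w;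
  prob_weights_sum1 : \sum_w mu w = 1
}.

Definition expect (mu f : Omega -> R) : R := \sum_w mu w * f w.

Definition positive_fun (f : Omega -> R) : Prop := forall w, 0 < f w.

(* The codomain is written R^o, the ring R seen as a module over itself, so
   that the function space carries its pointwise vector space structure. *)
Record generator (mu : Omega -> R)
    (L : {linear (Omega -> R^o) -> (Omega -> R^o)}) : Prop := Generator {
  generator_cst1 : forall w, L (fun=> 1) w = 0;
  generator_sym : forall f g : Omega -> R,
    expect mu (fun w => f w * L g w) = expect mu (fun w => g w * L f w);
  generator_ge0 : forall f : Omega -> R,
    0 <= expect mu (fun w => f w * L f w);
  generator_max : forall (f : Omega -> R) (w : Omega),
    (forall v, f v <= f w) -> 0 <= L f w
}.

(* T_t = exp (- t L) is the sum of the exponential power series, taken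
   pointwise; as Omega is finite, this is its sum in operator norm. *)
Definition semigroup (L : {linear (Omega -> R^o) -> (Omega -> R^o)})
    (t : R) (f : Omega -> R) (w : Omega) : R :=
  limn (series (fun k : nat => (- t) ^+ k / k`!%:R * iter k L f w)).

Definition dirichlet (mu : Omega -> R)
    (L : {linear (Omega -> R^o) -> (Omega -> R^o)}) (f g : Omega -> R) : R :=
  expect mu (fun w => f w * L g w).

(* Only meaningful for positive f. The semigroup of a generator preserves
   positivity, so pnorm mu q (semigroup L t f) involves no default value of
   powR or ln. *)
Definition pnorm (mu : Omega -> R) (p : R) (f : Omega -> R) : R :=
  if p == 0 then expR (expect mu (fun w => ln (f w)))
  else expect mu (fun w => f w `^ p) `^ p^-1.

Definition entropy (mu f : Omega -> R) : R :=
  expect mu (fun w => f w * ln (f w)) - expect mu f * ln (expect mu f).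

(* Only meaningful for 1 <= r and 0 < C. *)
Definition logSob (mu : Omega -> R)
    (L : {linear (Omega -> R^o) -> (Omega -> R^o)}) (r C : R) : Prop :=
  forall f : Omega -> R, positive_fun f ->
    if r == 1 then
      entropy mu f <= C / 4 * dirichlet mu L f (fun w => ln (f w))
    else
      entropy mu (fun w => f w `^ r) <=
        C * r ^+ 2 / (4 * (r - 1))
          * dirichlet mu L (fun w => f w `^ (r - 1)) f.

End FiniteMarkov.

(* Main.v *)
Require Import Defs.
From mathcomp Require Import all_boot all_order all_algebra.
From mathcomp Require Import all_classical all_reals all_analysis.
From mathcomp Require Import ring lra.
Set Implicit Arguments.
Unset Strict Implicit.
Unset Printing Implicit Defensive.
Import Order.TTheory GRing.Theory Num.Theory.
Import numFieldNormedType.Exports.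
Local Open Scope ring_scope.

(** The proof follows the norm of [T_s f] along a moving exponent.  Put
    [u s = T_s f] and let the exponent run from [p] down to [q] along
    [1 - q(s) = (1 - p) exp(kappa (s - a))].  The function
    [N(s) = ln (E (u s)^q(s)) / q(s)] is the logarithm of the norm in the
    statement, and its derivative is, up to a positive factor,
    [q'(s) Ent(g) - q(s)^2 E(u^(q(s)-1), u)] with [g = u^q(s)], where [E] with
    two arguments denotes the Dirichlet form.  So [N] is nondecreasing once the
    logarithmic Sobolev inequality is known for every nonzero exponent below 1,
    with a constant matching [kappa]
    ([path_entropy_production], [path_log_norm_le]).

    The inequality is transferred from the exponent [r >= 1] to those below 1
    through the exponent 1.  In terms of [g], the inequality of exponent [1/s]
    compares [Ent(g)] with [E(g^s, g^(1-s)) / (s (1-s))].  The generator is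
    the Laplacian of a graph with symmetric nonnegative weights
    ([dirichlet_conductanceE]), so Dirichlet forms can be compared pair of
    points by pair of points ([dirichlet_le]), and the two-point inequality
    [(x^s - y^s) (x^(1-s) - y^(1-s)) <= s (1-s) (x - y) (ln x - ln y)]
    holds for every real [s] ([powR_mixed_le]).  For [0 < s < 1] it derives the
    inequality of exponent 1 from that of exponent [r > 1]
    ([logSob_entropy_le]).  For [s < 0] or [s > 1] the factor [s (1-s)] is
    negative, dividing by it reverses the inequality, and the inequality of
    exponent 1 yields those of the exponents below 1.

    Three points remain.  The logarithms need [T_t f > 0], which follows from
    the decay of [E exp(-k T_t f)] for all [k >= 0] ([semigroup_ge]).  A time
    [t] beyond the critical one is handled by slowing the path, since a
    logarithmic Sobolev inequality survives an increase of its constant.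
    Finally [N] is singular where the exponent vanishes; the path argument is
    used only for exponents of one sign, and as the norm of exponent [p] tends
    to the geometric mean when [p] tends to 0 ([cvg_pnorm0]), the endpoint 0 is
    reached by a limit at a fixed time.  A path crossing 0 is cut there. *)

(** * The Dirichlet form as a sum over pairs of points *)

Section Kernel.
Context {R : realType} {Omega : finType}.
Implicit Types (mu f g : Omega -> R) (v w : Omega).
Implicit Types L : {linear (Omega -> R^o) -> (Omega -> R^o)}.

Definition point_mass v : Omega -> R := fun w => (w == v)%:R.

Lemma point_mass_expansion f :
  f = \sum_v (f v : R) *: (point_mass v : Omega -> R^o).
Proof.
apply/funext => w; rewrite fct_sumE.
transitivity (\sum_v f v * point_mass v w); last exact: eq_bigr.
rewrite (bigD1 w)//= big1 ?addr0 ?/point_mass ?eqxx ?mulr1// => v vw.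
by rewrite eq_sym (negbTE vw) mulr0.
Qed.

Lemma linear_kernelE L f w : L f w = \sum_v f v * L (point_mass v) w.
Proof.
rewrite {1}(point_mass_expansion f) linear_sum fct_sumE.
by apply: eq_bigr => v _; rewrite linearZ.
Qed.

Lemma expect_point_mass mu v f :
  expect mu (fun w => point_mass v w * f w) = mu v * f v.
Proof.
rewrite /expect (bigD1 v)//= big1 ?addr0.
  by rewrite /point_mass eqxx mul1r.
by move=> w wv; rewrite /point_mass (negbTE wv) mul0r mulr0.
Qed.

(** For [w != v], the weight of the edge between [w] and [v] in the electrical
    network with Laplacian [L]. *)
Definition conductance mu L w v : R := - (mu w * L (point_mass v) w).

Lemma conductance_sym mu L : generator mu L ->
  forall w v, conductance mu L w v = conductance mu L v w.
Proof.
move=> hL w v; have := generator_sym hL (point_mass w) (point_mass v).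
by rewrite !expect_point_mass /conductance => ->.
Qed.

(** The function [- point_mass v] attains its maximum 0 at every [w != v], so
    the maximum principle gives the sign of [L] there. *)
Lemma conductance_ge0 mu L : prob_weights mu -> generator mu L ->
  forall w v, w != v -> 0 <= conductance mu L w v.
Proof.
move=> hmu hL w v wv.
have : 0 <= L (fun u => - point_mass v u) w.
  apply: (generator_max hL) => u.
  by rewrite /point_mass (negbTE wv) oppr0 oppr_le0 ler0n.
rewrite (_ : (fun u => _) = - (point_mass v : Omega -> R^o))//.
rewrite linearN => h; rewrite /conductance -mulrN mulr_ge0//.
exact/ltW/(prob_weights_gt0 hmu).
Qed.

Lemma conductance_row_sum mu L : generator mu L ->
  forall w, \sum_v conductance mu L w v = 0.
Proof.
move=> hL w; rewrite sumrN -mulr_sumr.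
have := generator_cst1 hL w; rewrite linear_kernelE.
by under eq_bigr do rewrite mul1r; move=> ->; rewrite mulr0 oppr0.
Qed.

(** Expanding the product of differences, the two diagonal sums vanish as rows
    and columns of the conductance sum to 0, and the two cross sums are equal by
    symmetry. *)
Lemma dirichlet_conductanceE mu L f g : generator mu L ->
  dirichlet mu L f g =
    2^-1 * \sum_w \sum_v conductance mu L w v * ((f w - f v) * (g w - g v)).
Proof.
move=> hL; set c := conductance mu L.
have cross : \sum_w \sum_v c w v * (f w * g v) = - dirichlet mu L f g.
  rewrite /dirichlet /expect -sumrN; apply: eq_bigr => w _.
  rewrite linear_kernelE !mulr_sumr -sumrN; apply: eq_bigr => v _.
  by rewrite /c /conductance; ring.
have cross' : \sum_w \sum_v c w v * (f v * g w) = - dirichlet mu L f g.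
  rewrite exchange_big /= -cross; apply: eq_bigr => w _; apply: eq_bigr => v _.
  by rewrite /c conductance_sym.
have diag : \sum_w \sum_v c w v * (f w * g w) = 0.
  by apply: big1 => w _; rewrite -mulr_suml conductance_row_sum// mul0r.
have diag' : \sum_w \sum_v c w v * (f v * g v) = 0.
  rewrite exchange_big /= -[RHS]diag; apply: eq_bigr => w _.
  by apply: eq_bigr => v _; rewrite /c conductance_sym.
have -> : \sum_w \sum_v c w v * ((f w - f v) * (g w - g v)) =
    \sum_w \sum_v c w v * (f w * g w) - \sum_w \sum_v c w v * (f w * g v)
    - \sum_w \sum_v c w v * (f v * g w) + \sum_w \sum_v c w v * (f v * g v).
  rewrite -!sumrB -big_split /=; apply: eq_bigr => w _.
  by rewrite -!sumrB -big_split /=; apply: eq_bigr => v _; ring.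
by rewrite cross cross' diag diag'; field.
Qed.

(** Inequalities between numbers become inequalities between Dirichlet forms:
    the conductances of distinct points are nonnegative, and on the diagonal
    all differences are 0. *)
Lemma dirichlet_le mu L f g f' g' (k : R) :
  prob_weights mu -> generator mu L ->
  (forall w v,
    (f w - f v) * (g w - g v) <= k * ((f' w - f' v) * (g' w - g' v))) ->
  dirichlet mu L f g <= k * dirichlet mu L f' g'.
Proof.
move=> hmu hL h; rewrite !dirichlet_conductanceE//.
rewrite mulrCA ler_pM2l ?invr_gt0// mulr_sumr; apply: ler_sum => w _.
rewrite mulr_sumr; apply: ler_sum => v _.
have [->|wv] := eqVneq w v; first by rewrite !subrr !mul0r !mulr0.
by rewrite [leRHS]mulrCA ler_wpM2l// conductance_ge0.
Qed.

Lemma dirichlet_ge0 mu L f g :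
  prob_weights mu -> generator mu L ->
  (forall w v, 0 <= (f w - f v) * (g w - g v)) -> 0 <= dirichlet mu L f g.
Proof.
move=> hmu hL h; rewrite dirichlet_conductanceE// mulr_ge0//.
apply: sumr_ge0 => w _; apply: sumr_ge0 => v _.
have [->|wv] := eqVneq w v; first by rewrite subrr mul0r mulr0.
by rewrite mulr_ge0// conductance_ge0.
Qed.

End Kernel.

(** * The two-point inequality *)

Section Pointwise.
Local Open Scope classical_set_scope.
Local Open Scope ring_scope.
Context {R : realType}.
Implicit Types k u s x y : R.

Lemma bernoulli_ge x n : 0 <= x -> 1 + n%:R * (x - 1) <= x ^+ n.
Proof.
move=> x0; elim: n => [|n IH]; first by rewrite mul0r addr0 expr0.
rewrite exprS; apply: le_trans (_ : x * (1 + n%:R * (x - 1)) <= _);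
  last by rewrite ler_wpM2l.
rewrite -natr1 -subr_ge0.
rewrite (_ : _ - _ = n%:R * (x - 1) ^+ 2); last by ring.
by rewrite mulr_ge0// sqr_ge0.
Qed.

(** This is [cosh u + (k^2 - 1) u sinh u / 2 <= cosh (k u)], up to a factor 2:
    the graph of the convex function [y |-> cosh (u sqrt y)] lies above its
    tangent at [y = 1], and this is read at [y = k^2].  It is
    proved on the power series in [u], whose terms of even degree [2 m] are
    compared by [1 + m (k^2 - 1) <= (k^2)^m]. *)
Lemma expR_add_opp_ge k u :
  expR u + expR (- u) + (k ^+ 2 - 1) / 2 * (u * expR u + (- u) * expR (- u)) <=
  expR (k * u) + expR (- (k * u)).
Proof.
pose S x N : R := series (exp_coeff x) N.
have cS x : S x @ \oo --> expR x by exact: is_cvg_series_exp_coeff.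
have cS' x : S x N.+1 @[N --> \oo] --> expR x by rewrite cvg_shiftS.
pose lhs N := S u N.+1 + S (- u) N.+1
  + (k ^+ 2 - 1) / 2 * (u * S u N + (- u) * S (- u) N).
pose rhs N := S (k * u) N.+1 + S (- (k * u)) N.+1.
have cl : lhs @ \oo --> expR u + expR (- u)
    + (k ^+ 2 - 1) / 2 * (u * expR u + (- u) * expR (- u)).
  apply: cvgD; first exact: cvgD.
  apply: cvgM; first exact: cvg_cst.
  apply: cvgD; (apply: cvgM; [exact: cvg_cst|exact: cS]).
have cr : rhs @ \oo --> expR (k * u) + expR (- (k * u)) by apply: cvgD.
rewrite -(cvg_lim _ cl)// -(cvg_lim _ cr)//.
apply: ler_lim; [by apply: cvgP cl|by apply: cvgP cr|].
(* The factor x raises the degree by one, so one more term of the other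
   partial sums is needed to compare them degree by degree. *)
have shift x N : x * S x N = \sum_(0 <= j < N.+1) j%:R * exp_coeff x j.
  rewrite big_nat_recl//= mul0r add0r mulr_sumr; apply: eq_bigr => j _.
  rewrite /exp_coeff /= factS natrM exprS invfM.
  by rewrite [RHS]mulrCA mulVKf ?pnatr_eq0// -mulrA.
apply: nearW => N; rewrite /lhs /rhs !shift /S /series /=.
rewrite -!big_split /= mulr_sumr -big_split /=; apply: ler_sum => j _.
rewrite /exp_coeff /= -subr_ge0.
rewrite (_ : _ - _ = (u ^+ j + (- u) ^+ j) / j`!%:R *
  (k ^+ j - 1 - j%:R / 2 * (k ^+ 2 - 1))); last first.
  rewrite -mulrN !exprMn; field.
  by rewrite pnatr_eq0 -lt0n fact_gt0.
(* Terms of odd degree cancel. *)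
have := odd_double_half j; case: (odd j) => /= <-.
  rewrite add1n -mul2n [u ^+ _]exprS [(- u) ^+ _]exprS !exprM sqrrN.
  by rewrite mulNr subrr !mul0r.
rewrite add0n.
have -> : (j./2.*2)%:R / 2 = j./2%:R :> R by rewrite -muln2 natrM; field.
rewrite -mul2n !exprM sqrrN mulr_ge0//.
  by rewrite mulr_ge0// ?invr_ge0// addr_ge0// exprn_ge0// sqr_ge0.
have := @bernoulli_ge (k ^+ 2) j./2 (sqr_ge0 k); lra.
Qed.

Lemma powR_expR x s : 0 < x -> x `^ s = expR (s * ln x).
Proof. by move=> x0; rewrite /powR gt_eqF. Qed.

(** With [m] the geometric mean of [x] and [y] and [x / y = exp (2 u)], the left
    side is [x + y - 2 m cosh ((2 s - 1) u)], so that this is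
    [expR_add_opp_ge] at [k = 2 s - 1], where
    [k^2 - 1 = - 4 s (1 - s)].  It holds for both signs of [s (1 - s)], hence is
    usable on both sides of the exponent 1. *)
Lemma powR_mixed_le x y s : 0 < x -> 0 < y ->
  (x `^ s - y `^ s) * (x `^ (1 - s) - y `^ (1 - s)) <=
  s * (1 - s) * ((x - y) * (ln x - ln y)).
Proof.
move=> x0 y0.
pose m := expR ((ln x + ln y) / 2); pose u := (ln x - ln y) / 2.
have m0 : 0 < m by exact: expR_gt0.
have eE (z : R) : 0 < z -> z = expR (ln z) by move=> z0; rewrite lnK.
have xE : x = m * expR u.
  by rewrite -expRD {1}(eE x)//; congr expR; rewrite /u; field.
have yE : y = m * expR (- u).
  by rewrite -expRD {1}(eE y)//; congr expR; rewrite /u; field.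
have -> : (x `^ s - y `^ s) * (x `^ (1 - s) - y `^ (1 - s)) =
   x + y - m * (expR ((2 * s - 1) * u) + expR (- ((2 * s - 1) * u))).
  have split (z : R) : 0 < z -> z `^ s * z `^ (1 - s) = z.
    move=> z0; rewrite -powRD ?(gt_eqF z0) ?implybT//.
    by rewrite addrC subrK powRr1// ltW.
  rewrite mulrBl !mulrBr !split//.
  rewrite mulrDr !powR_expR// -!expRD.
  have -> : (ln x + ln y) / 2 + (2 * s - 1) * u = s * ln x + (1 - s) * ln y.
    by rewrite /u; field.
  have -> : (ln x + ln y) / 2 - (2 * s - 1) * u = s * ln y + (1 - s) * ln x.
    by rewrite /u; field.
  by ring.
have -> : ln x - ln y = 2 * u by rewrite /u; field.
have := expR_add_opp_ge (2 * s - 1) u; rewrite -(ler_pM2l m0) {1 2}xE {1 2}yE.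
set a := expR u; set b := expR (- u); set c := expR _ + expR _ => h.
rewrite -subr_ge0 in h; rewrite -subr_ge0.
by apply: le_trans h _; rewrite le_eqVlt; apply/orP; left; apply/eqP; field.
Qed.

End Pointwise.

(** * Derivatives of real functions *)

Section Derivatives.
Context {R : realType}.
Implicit Types (f g : R -> R) (s x : R).

Lemma is_derive_fun_mul f g s (df dg : R) :
  is_derive s 1 f df -> is_derive s 1 g dg ->
  is_derive s 1 (fun t => f t * g t) (df * g s + f s * dg).
Proof.
move=> hf hg; have h := is_deriveM hf hg.
by apply: (is_derive_eq h); rewrite /GRing.scale /= addrC [g s * df]mulrC.
Qed.

Lemma is_derive_fun_scale f (c s df : R) :
  is_derive s 1 f df -> is_derive s 1 (fun t => c * f t) (c * df).
Proof.
move=> hf.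
have hc : is_derive s 1 (cst c : R -> R) (0 : R) by exact: is_derive_cst.
by have := is_derive_fun_mul hc hf; rewrite mul0r add0r.
Qed.

Lemma is_derive_fun_expR f (s df : R) :
  is_derive s 1 f df -> is_derive s 1 (fun t => expR (f t)) (df * expR (f s)).
Proof.
move=> hf; rewrite mulrC.
exact: (is_derive1_comp (is_derive_expR (f s)) hf).
Qed.

Lemma is_derive_fun_ln f (s df : R) : 0 < f s ->
  is_derive s 1 f df -> is_derive s 1 (fun t => ln (f t)) (df / f s).
Proof.
move=> fs0 hf.
have dln : is_derive (f s) 1 (@ln R) (f s)^-1 by exact: is_derive1_ln.
by rewrite mulrC; exact: (is_derive1_comp dln hf).
Qed.

Lemma is_derive_fun_sum (I : Type) (r : seq I) (h : R -> I -> R)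
    (dh : I -> R) s :
  (forall i, is_derive s 1 (h^~ i) (dh i)) ->
  is_derive s 1 (fun t => \sum_(i <- r) h t i) (\sum_(i <- r) dh i).
Proof.
move=> hd; elim: r => [|i r IH].
  rewrite big_nil (_ : (fun t => _) = cst 0); first exact: is_derive_cst.
  by apply/funext => t; rewrite big_nil.
rewrite big_cons (_ : (fun t => _) = h^~ i + (fun t => \sum_(j <- r) h t j)).
  exact: is_deriveD.
by apply/funext => t; rewrite big_cons.
Qed.

Lemma nondecreasing_of_is_derive f (df : R -> R) (a b : R) : a <= b ->
  (forall x, a <= x -> x <= b -> is_derive x 1 f (df x)) ->
  (forall x, a <= x -> x <= b -> 0 <= df x) -> f a <= f b.
Proof.
move=> ab hd h0.
have [c] : exists2 c, c \in `[a, b]%R & f b - f a = df c * (b - a).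
  apply: MVT_segment => // [x|].
    by rewrite in_itv/= => /andP[ax xb]; apply: hd; exact: ltW.
  apply: derivable_within_continuous => x; rewrite in_itv/= => /andP[ax xb].
  exact/ex_derive/hd.
rewrite in_itv/= => /andP[ac cb] e.
by rewrite -subr_ge0 e mulr_ge0 ?h0 ?subr_ge0.
Qed.

Lemma nonincreasing_of_is_derive f (df : R -> R) (a b : R) : a <= b ->
  (forall x, a <= x -> x <= b -> is_derive x 1 f (df x)) ->
  (forall x, a <= x -> x <= b -> df x <= 0) -> f b <= f a.
Proof.
move=> ab hd h0; rewrite -lerN2.
apply: (@nondecreasing_of_is_derive (- f) (- df) _ _ ab) => x ax xb.
  exact/is_deriveN/hd.
by rewrite oppr_ge0 h0.
Qed.

End Derivatives.

(** * The semigroup solves the heat equation *)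

Section Semigroup.
Local Open Scope classical_set_scope.
Local Open Scope ring_scope.
Context {R : realType} {Omega : finType}.
Variable L : {linear (Omega -> R^o) -> (Omega -> R^o)}.
Implicit Types (f g : Omega -> R) (v w : Omega) (s t K : R).

Definition semigroup_coeff f w (k : nat) : R :=
  (-1) ^+ k / k`!%:R * iter k L f w.

Lemma semigroup_pseriesE f w t :
  semigroup L t f w = limn (pseries (semigroup_coeff f w) t).
Proof.
rewrite /semigroup /pseries; congr (limn (series _)); apply/funext => k.
rewrite /semigroup_coeff -[- t]mulN1r exprMn.
by rewrite [RHS]mulrAC [_ / _ * t ^+ k]mulrAC.
Qed.

Lemma iter_generator_bounded f : exists M B : R, [/\ 0 <= M, 0 <= B &
  forall k w, `|iter k L f w| <= M ^+ k * B].
Proof.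
pose M := \sum_v \sum_w `|L (point_mass v) w|.
exists M, (\sum_v `|f v|); split; [|exact: sumr_ge0|].
  by do 2 apply: sumr_ge0 => ? _.
set B := \sum_v _.
elim=> [|k IH] w; first by rewrite expr0 mul1r /B (bigD1 w)//= lerDl sumr_ge0.
rewrite iterS linear_kernelE (le_trans (ler_norm_sum _ _ _))//.
rewrite exprS -mulrA mulr_suml; apply: ler_sum => v _.
rewrite normrM mulrC ler_pM// (bigD1 w)//= lerDl.
exact: sumr_ge0.
Qed.

(** Domination by the exponential series of [M |t|], where [M] bounds the
    growth of the powers of [L]. *)
Lemma is_cvg_semigroup_series f w t : cvgn (pseries (semigroup_coeff f w) t).
Proof.
have [M [B [M0 B0 hB]]] := iter_generator_bounded f.
apply: normed_cvg; rewrite /normed_series_of /=.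
apply: (@series_le_cvg _ _ (B *: exp_coeff (M * `|t|))) => [n //|n|n|].
- by apply: mulr_ge0 => //; rewrite exp_coeff_ge0// mulr_ge0.
- rewrite /semigroup_coeff !normrM normrX normrN1 expr1n mul1r normfV.
  rewrite normr_nat normrX.
  apply: (@le_trans _ _ (n`!%:R^-1 * (M ^+ n * B) * `|t| ^+ n)).
    by rewrite ler_wpM2r ?exprn_ge0// ler_wpM2l ?invr_ge0.
  rewrite [leRHS]/(B * ((M * `|t|) ^+ n / n`!%:R)) exprMn.
  move: (_^-1) (M ^+ n) (`|t| ^+ n) => x y z.
  by rewrite (_ : x * (y * B) * z = B * (y * z * x))//; ring.
- exact/is_cvg_seriesZ/is_cvg_series_exp_coeff.
Qed.

(** On coefficients, the heat equation is this shift of the exponential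
    series. *)
Lemma pseries_diffs_semigroup_coeff f w :
  pseries_diffs (semigroup_coeff f w) = - semigroup_coeff (L f) w.
Proof.
apply/funext => k.
rewrite [RHS]/(- (semigroup_coeff (L f) w k)) /pseries_diffs.
rewrite /semigroup_coeff -iterSr.
rewrite factS natrM invfM exprS mulN1r !mulNr mulrN; congr (- _).
by rewrite mulrA mulrCA mulVKf// pnatr_eq0.
Qed.

Lemma pseriesN (c : R^nat) t : pseries (- c) t = - pseries c t.
Proof.
apply/funext => n; rewrite /pseries /series /= -[RHS]sumrN.
by apply: eq_bigr => i _; rewrite -mulNr.
Qed.

(** As [Omega] is finite, [L] is a finite sum of evaluations, hence passes to
    the pointwise limit of the series. *)
Lemma semigroup_generator_comm f w t :
  semigroup L t (L f) w = L (semigroup L t f) w.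
Proof.
rewrite linear_kernelE semigroup_pseriesE.
apply: cvg_lim => //.
rewrite (_ : pseries _ t = fun n =>
    \sum_v pseries (semigroup_coeff f v) t n * L (point_mass v) w).
  apply: cvg_big => [|v _]; first exact: add_continuous.
  rewrite semigroup_pseriesE; apply: cvgM; last exact: cvg_cst.
  exact: is_cvg_semigroup_series.
apply/funext => n; rewrite /pseries /series /=.
under [RHS]eq_bigr do rewrite mulr_suml.
rewrite exchange_big /=; apply: eq_bigr => k _.
rewrite /semigroup_coeff -iterSr iterS linear_kernelE mulr_sumr mulr_suml.
by apply: eq_bigr => v _; ring.
Qed.

Lemma is_derive_semigroup f w t :
  is_derive t 1 (fun s => semigroup L s f w) (- L (semigroup L t f) w).
Proof.
rewrite (_ : (fun s => _) =
    (fun s => limn (pseries (semigroup_coeff f w) s))); last first.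
  by apply/funext => s; rewrite semigroup_pseriesE.
rewrite -semigroup_generator_comm semigroup_pseriesE.
rewrite (_ : - limn _ =
    limn (pseries (pseries_diffs (semigroup_coeff f w)) t)); last first.
  rewrite pseries_diffs_semigroup_coeff pseriesN.
  apply/esym/cvg_lim => //.
  by apply: cvgN; exact: is_cvg_semigroup_series.
apply: (@pseries_snd_diffs _ _ (`|t| + 1)).
- exact: is_cvg_semigroup_series.
- rewrite pseries_diffs_semigroup_coeff pseriesN; apply: is_cvgN.
  exact: is_cvg_semigroup_series.
- rewrite pseries_diffs_semigroup_coeff pseries_diffsN.
  rewrite pseries_diffs_semigroup_coeff opprK.
  exact: is_cvg_semigroup_series.
- by rewrite [ltRHS]ger0_norm ?ltrDl// addr_ge0.
Qed.

Lemma semigroup0 f w : semigroup L 0 f w = f w.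
Proof.
rewrite semigroup_pseriesE; apply: cvg_lim => //.
rewrite -cvg_shiftS /=.
rewrite (_ : (fun n => _) = cst (f w)); first exact: cvg_cst.
apply/funext => n; rewrite /pseries /series /= big_nat_recl//= big1 ?addr0.
  by rewrite /semigroup_coeff /= !expr0 fact0 divr1 !mul1r mulr1.
by move=> i _; rewrite exprS mul0r mulr0.
Qed.

End Semigroup.

(** * Moments, and the norm of exponent 0 as a limit *)

Section Expectation.
Context {R : realType} {Omega : finType}.
Variable mu : Omega -> R.
Hypothesis hmu : prob_weights mu.
Implicit Types (f g : Omega -> R) (w : Omega) (s p q : R).

Lemma expect_cst (c : R) : expect mu (fun=> c) = c.
Proof. by rewrite /expect -mulr_suml (prob_weights_sum1 hmu) mul1r. Qed.

Lemma expect_le f g : (forall w, f w <= g w) -> expect mu f <= expect mu g.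
Proof.
move=> fg; apply: ler_sum => w _; rewrite ler_wpM2l//.
exact/ltW/(prob_weights_gt0 hmu).
Qed.

Lemma weight_le_expect f w : (forall v, 0 <= f v) -> mu w * f w <= expect mu f.
Proof.
move=> f0; rewrite /expect (bigD1 w)//= lerDl sumr_ge0// => v _.
by rewrite mulr_ge0// ltW// (prob_weights_gt0 hmu).
Qed.

Lemma prob_weights_inhabited : exists w : Omega, true.
Proof.
have [w _|none] := pickP (@predT Omega); first by exists w.
have := prob_weights_sum1 hmu; rewrite big1 => [/eqP|w _].
  by rewrite eq_sym oner_eq0.
by have := none w.
Qed.

Lemma expect_gt0 f : positive_fun f -> 0 < expect mu f.
Proof.
move=> f0; have [w _] := prob_weights_inhabited.
apply: lt_le_trans (@weight_le_expect f w _) => [|v].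
  by rewrite mulr_gt0// (prob_weights_gt0 hmu).
exact/ltW/f0.
Qed.

Lemma is_derive_expect_expR (h : R -> Omega -> R) (dh : Omega -> R) s :
  (forall w, is_derive s 1 (h^~ w) (dh w)) ->
  is_derive s 1 (fun t => expect mu (fun w => expR (h t w)))
    (expect mu (fun w => dh w * expR (h s w))).
Proof.
move=> hd.
apply: (@is_derive_fun_sum _ _ _ (fun t w => mu w * expR (h t w))) => w.
exact/is_derive_fun_scale/is_derive_fun_expR.
Qed.

Definition log_moment p f : R :=
  ln (expect mu (fun w => expR (p * ln (f w)))).

Lemma expect_expR_gt0 (X : Omega -> R) : 0 < expect mu (fun w => expR (X w)).
Proof. by apply: expect_gt0 => w; exact: expR_gt0. Qed.

Lemma pnormE p f : positive_fun f -> p != 0 ->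
  pnorm mu p f = expR (p^-1 * log_moment p f).
Proof.
move=> f0 p0; rewrite /pnorm (negbTE p0) /log_moment.
rewrite (_ : expect mu (fun w => f w `^ p) =
  expect mu (fun w => expR (p * ln (f w)))).
  by rewrite powR_expR// expect_expR_gt0.
by apply: eq_bigr => w _; rewrite powR_expR.
Qed.

(** The logarithm of the norm of exponent [p] is the difference quotient at 0 of
    [p |-> ln (E f^p)], a function which vanishes at 0 and has derivative
    [E (ln f)] there. *)
Lemma cvg_pnorm0 f : positive_fun f ->
  (pnorm mu p f @[p --> 0^'] --> pnorm mu 0 f)%classic.
Proof.
move=> f0.
set E := expect mu (fun w => ln (f w)).
pose A p := expect mu (fun w => expR (p * ln (f w))).
have A0 : A 0 = 1.
  by rewrite -[RHS]expect_cst; apply: eq_bigr => w _; rewrite mul0r expR0.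
have dA : is_derive (0 : R) (1 : R) A E.
  have -> : E = expect mu (fun w => ln (f w) * expR (0 * ln (f w))).
    by apply: eq_bigr => w _; rewrite mul0r expR0 mulr1.
  apply: (@is_derive_expect_expR (fun p w => p * ln (f w))) => w.
  have h := is_derive_fun_scale (ln (f w)) (is_derive_id (0 : R) (1 : R)).
  rewrite mulr1 in h; congr (is_derive _ _ _ _): h.
  by apply/funext => p /=; rewrite mulrC.
have d : is_derive (0 : R) (1 : R) (log_moment^~ f) E.
  have := is_derive_fun_ln _ dA; rewrite A0 divr1; apply; exact: ltr01.
have slope : (p^-1 * log_moment p f @[p --> 0^'] --> E)%classic.
  have [dl <-] := d; move: dl => /cvg_ex[l hl].
  have <- : l = 'D_1 (log_moment^~ f) 0 by apply/esym/cvg_lim.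
  suff e : (fun p => p^-1 * log_moment p f) =
      (fun p => p^-1 *: (log_moment (p *: 1 + 0) f - log_moment 0 f)).
    by rewrite e.
  apply/funext => p; rewrite [_ *: 1]mulr1 addr0.
  by rewrite [log_moment 0 f](_ : _ = 0) ?subr0// /log_moment -/(A 0) A0 ln1.
rewrite {2}/pnorm eqxx -/E.
apply: (@cvg_trans _ (expR (p^-1 * log_moment p f) @[p --> 0^'])%classic).
  apply: near_eq_cvg; near=> p; rewrite pnormE//.
  by near: p; exact: nbhs_dnbhs_neq.
apply: continuous_cvg => //; exact: continuous_expR.
Unshelve. all: by end_near. Qed.

End Expectation.

(** * The semigroup preserves lower bounds *)

Section Positivity.
Context {R : realType} {Omega : finType}.
Variables (mu : Omega -> R) (L : {linear (Omega -> R^o) -> (Omega -> R^o)}).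
Hypotheses (hmu : prob_weights mu) (hL : generator mu L).
Implicit Types (f g : Omega -> R) (w : Omega) (s t k m : R).

(** With [u = T_s f], the derivative at [s] is [k] times the Dirichlet form of
    [exp (- k u)] and [u], which is nonpositive because
    [exp (- k x)] is nonincreasing in [x]. *)
Lemma expect_expR_semigroup_le f k t : 0 <= k -> 0 <= t ->
  expect mu (fun w => expR (- k * semigroup L t f w)) <=
  expect mu (fun w => expR (- k * f w)).
Proof.
move=> k0 t0.
set A := fun s => expect mu (fun w => expR (- k * semigroup L s f w)).
have -> : expect mu (fun w => expR (- k * f w)) = A 0.
  by apply: eq_bigr => w _; rewrite semigroup0.
apply: (nonincreasing_of_is_derive t0) => [s s0 st|s s0 st].
  apply: is_derive_expect_expR => w.
  exact: is_derive_fun_scale (is_derive_semigroup L f w s).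
rewrite /=; set u := semigroup L s f.
rewrite (_ : expect _ _ = k * dirichlet mu L (fun w => expR (- k * u w)) u).
  rewrite mulr_ge0_le0//; rewrite -[leRHS](mul0r (dirichlet mu L u u)).
  apply: dirichlet_le => // w v; rewrite mul0r.
  have [wv|vw] := lerP (u w) (u v).
    by rewrite mulr_ge0_le0 ?subr_ge0 ?subr_le0// ler_expR !mulNr lerN2 ler_wpM2l.
  rewrite mulr_le0_ge0 ?subr_ge0 ?subr_le0 ?(ltW vw)// ler_expR !mulNr lerN2.
  by rewrite ler_wpM2l// ltW.
rewrite /dirichlet /expect mulr_sumr; apply: eq_bigr => w _ /=.
by ring.
Qed.

(** If [T_t f w = u < m], [expect_expR_semigroup_le] gives
    [mu w * exp (- k u) <= exp (- k m)] for every [k >= 0], which fails for [k]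
    large. *)
Lemma semigroup_ge f m t w : (forall v, m <= f v) -> 0 <= t ->
  m <= semigroup L t f w.
Proof.
move=> mf t0; rewrite leNgt; apply/negP; rewrite -subr_gt0.
set u := semigroup L t f w => um.
have mu0 := prob_weights_gt0 hmu w.
(* With this k the bound reads mu w * exp (1 / mu w) <= 1, against
   exp x >= 1 + x. *)
pose k := (mu w)^-1 / (m - u).
have k0 : 0 <= k by rewrite /k divr_ge0// ?ltW// invr_gt0.
have : mu w * expR (- k * u) <= expR (- k * m).
  apply: le_trans (_ : expect mu (fun w => expR (- k * semigroup L t f w)) <= _).
    pose F v := expR (- k * semigroup L t f v).
    by apply: (@weight_le_expect _ _ _ hmu F) => v; exact/ltW/expR_gt0.
  apply: (le_trans (expect_expR_semigroup_le f k0 t0)).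
  rewrite -[leRHS](expect_cst hmu); apply: expect_le => // v.
  by rewrite ler_expR !mulNr lerN2 ler_wpM2l.
rewrite -(ler_pM2r (expR_gt0 (k * m))) -mulrA -!expRD.
rewrite [- k * m]mulNr addNr expR0.
rewrite (_ : - k * u + k * m = (mu w)^-1); last first.
  by rewrite /k; field; rewrite !gt_eqF.
have : mu w * (1 + (mu w)^-1) <= mu w * expR (mu w)^-1.
  by rewrite ler_pM2l// expR_ge1Dx.
by rewrite mulrDr mulfV ?gt_eqF// mulr1 => h1 h2; have := le_trans h1 h2; lra.
Qed.

Lemma semigroup_gt0 f t : positive_fun f -> 0 <= t ->
  positive_fun (semigroup L t f).
Proof.
(* The inverse of the sum of the 1 / f v is a positive lower bound of f. *)
move=> f0 t0 w; pose S := \sum_v (f v)^-1.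
have S0 : 0 < S.
  rewrite /S (bigD1 w)//= ltr_wpDr ?invr_gt0 ?f0// sumr_ge0// => v _.
  by rewrite invr_ge0 ltW.
apply: (@lt_le_trans _ _ S^-1); first by rewrite invr_gt0.
apply: semigroup_ge => // v; rewrite -[leRHS]invrK lef_pV2 ?posrE ?invr_gt0 ?f0//.
by rewrite /S (bigD1 v)//= lerDl sumr_ge0// => z _; rewrite invr_ge0 ltW.
Qed.

End Positivity.

(** * Logarithmic Sobolev inequalities for all exponents *)

Section ReverseHypercontractivity.
Context {R : realType} {Omega : finType}.
Variables (mu : Omega -> R) (L : {linear (Omega -> R^o) -> (Omega -> R^o)}).
Hypotheses (hmu : prob_weights mu) (hL : generator mu L).
Implicit Types (f g u : Omega -> R) (w : Omega) (a b s t p q : R).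

Lemma dirichlet_powR_le g s : positive_fun g ->
  dirichlet mu L (fun w => g w `^ s) (fun w => g w `^ (1 - s)) <=
  s * (1 - s) * dirichlet mu L g (fun w => ln (g w)).
Proof. by move=> g0; apply: dirichlet_le => // w v; exact: powR_mixed_le. Qed.

Lemma dirichlet_ln_ge0 g : positive_fun g ->
  0 <= dirichlet mu L g (fun w => ln (g w)).
Proof.
move=> g0; apply: dirichlet_ge0 => // w v.
have [h|/ltW h] := lerP (g w) (g v).
  by rewrite mulr_le0// subr_le0// ler_ln ?posrE.
by rewrite mulr_ge0// subr_ge0// ler_ln ?posrE.
Qed.

(** For [r > 1], the hypothesis is applied to [g^(1/r)], and the two-point
    inequality with [1 - s = 1/r] in [(0, 1)] compares the resulting Dirichlet
    form with that of exponent 1; the constants [r^2 / (r - 1)] and [s (1 - s)]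
    cancel. *)
Lemma logSob_entropy_le r C g : 1 <= r -> 0 < C -> logSob mu L r C ->
  positive_fun g ->
  entropy mu g <= C / 4 * dirichlet mu L g (fun w => ln (g w)).
Proof.
move=> r1 C0 hLS g0; have [r_eq1|rn1] := eqVneq r 1.
  by have := hLS g g0; rewrite r_eq1 eqxx.
have r0 : 0 < r by exact: lt_le_trans r1.
have rm1 : 0 < r - 1 by rewrite subr_gt0 lt_neqAle eq_sym rn1.
have f0 : positive_fun (fun w => g w `^ r^-1) by move=> w; exact: powR_gt0.
have := hLS _ f0; rewrite (negbTE rn1).
have -> : (fun w => (g w `^ r^-1) `^ r) = g.
  by apply/funext => w; rewrite -powRrM mulVf ?gt_eqF// powRr1// ltW.
have -> : (fun w => (g w `^ r^-1) `^ (r - 1)) = (fun w => g w `^ (1 - r^-1)).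
  by apply/funext => w; rewrite -powRrM mulrBr mulVf ?gt_eqF// mulr1.
move=> h; apply: (le_trans h).
have hD := dirichlet_powR_le (1 - r^-1) g0; rewrite subKr in hD.
apply: (@le_trans _ _ (C * r ^+ 2 / (4 * (r - 1)) *
   ((1 - r^-1) * r^-1 * dirichlet mu L g (fun w => ln (g w))))).
  by rewrite ler_wpM2l ?hD// divr_ge0// ?mulr_ge0//
       ?(ltW C0) ?(ltW rm1) ?(ltW r0)//.
rewrite mulrA le_eqVlt (_ : _ / _ * _ = C / 4) ?eqxx//.
by field; rewrite !gt_eqF.
Qed.

(** * Monotonicity of the norm along the path of exponents *)

(** The solution of [q' = kappa (q - 1)] with [q(a) = p]: the logarithmic
    Sobolev inequality of exponent [q] has the factor [q^2 / (q - 1)], and this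
    equation makes it proportional to [q^2 / q'], the factor that appears when
    the norm is differentiated. *)
Definition exponent_path (kappa a p s : R) : R :=
  1 - (1 - p) * expR (kappa * (s - a)).

Lemma is_derive_exponent_path kappa a p s :
  is_derive s (1 : R) (exponent_path kappa a p)
    (kappa * (exponent_path kappa a p s - 1)).
Proof.
have d1 : is_derive s (1 : R) (fun s => kappa * (s - a)) (kappa * 1).
  apply: is_derive_fun_scale.
  have h := is_deriveB (is_derive_id s (1 : R)) (is_derive_cst a s (1 : R)).
  by rewrite subr0 in h.
have d2 := is_deriveB (is_derive_cst (1 : R) s (1 : R))
  (is_derive_fun_scale (1 - p) (is_derive_fun_expR d1)).
by apply: (is_derive_eq d2); rewrite /exponent_path; ring.
Qed.

Section Path.
Variables (kappa a p : R) (f : Omega -> R).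
Hypotheses (f0 : positive_fun f) (a0 : 0 <= a).
Hypothesis entropy_le : forall g, positive_fun g ->
  kappa * entropy mu g <= dirichlet mu L g (fun w => ln (g w)).

Let q := exponent_path kappa a p.
Let u s := semigroup L s f.
Let A s := expect mu (fun w => expR (q s * ln (u s w))).
Let dA s := expect mu (fun w =>
  (kappa * (q s - 1) * ln (u s w) - q s * (L (u s) w / u s w)) *
    expR (q s * ln (u s w))).

Lemma is_derive_path_moment s : a <= s -> is_derive s (1 : R) A (dA s).
Proof.
move=> as_.
apply: (@is_derive_expect_expR _ _ _ (fun s w => q s * ln (u s w))) => w.
have us0 : 0 < u s w by apply: (semigroup_gt0 hmu) => //; exact: le_trans as_.
have d1 := is_derive_fun_ln us0 (is_derive_semigroup L f w s).
have d := is_derive_fun_mul (is_derive_exponent_path kappa a p s) d1.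
by apply: (is_derive_eq d); rewrite mulNr mulrN.
Qed.

(** With [g = u^q], the difference of the two sides is
    [kappa (q - 1) Ent(g) - q^2 E(u^(q-1), u)].  The two-point inequality at
    [s = 1/q] bounds [q^2 E(u^(q-1), u)] by [(q - 1) E(g, ln g)], and since
    [q - 1 < 0] the inequality of exponent 1 bounds the latter by
    [kappa (q - 1) Ent(g)]. *)
Lemma path_entropy_production s : a <= s -> q s < 1 -> q s != 0 ->
  kappa * (q s - 1) * (A s * ln (A s)) <= q s * dA s.
Proof.
move=> as_ q1 q0.
have us0 : positive_fun (u s).
  by apply: (semigroup_gt0 hmu) => //; exact: le_trans as_.
pose g w := u s w `^ q s.
have g0 : positive_fun g by move=> w; exact: powR_gt0.
have gE w : expR (q s * ln (u s w)) = g w by rewrite /g powR_expR.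
have AE : A s = expect mu g by apply: eq_bigr => w _; rewrite gE.
have := dirichlet_powR_le (q s)^-1 g0.
have -> : (fun w => g w `^ (q s)^-1) = u s.
  by apply/funext => w; rewrite /g -powRrM mulfV// powRr1// ltW.
have -> : (fun w => g w `^ (1 - (q s)^-1)) = (fun w => u s w `^ (q s - 1)).
  by apply/funext => w; rewrite /g -powRrM mulrBr mulfV// mulr1.
set D := dirichlet mu L (u s) _ => hD.
have {}hD : q s ^+ 2 * D <= (q s - 1) * dirichlet mu L g (fun w => ln (g w)).
  apply: (@le_trans _ _ (q s ^+ 2 * ((q s)^-1 * (1 - (q s)^-1) *
      dirichlet mu L g (fun w => ln (g w))))); first by rewrite ler_wpM2l ?sqr_ge0.
  by rewrite mulrA le_eqVlt (_ : _ ^+ 2 * _ = q s - 1) ?eqxx//; field.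
have hE : (q s - 1) * dirichlet mu L g (fun w => ln (g w)) <=
    (q s - 1) * (kappa * entropy mu g).
  by rewrite ler_wnM2l ?entropy_le// subr_le0 ltW.
have DE : D = expect mu (fun w => u s w `^ (q s - 1) * L (u s) w).
  by rewrite /D /dirichlet (generator_sym hL).
have -> : q s * dA s = kappa * (q s - 1) * expect mu (fun w => g w * ln (g w))
    - q s ^+ 2 * D.
  rewrite DE /dA /expect !mulr_sumr -sumrB; apply: eq_bigr => w _.
  have -> : u s w `^ (q s - 1) = g w / u s w.
    by rewrite powRB ?(gt_eqF (us0 w)) ?implybT// powRr1// ltW.
  rewrite gE [ln (g w)]ln_powR; move: (L (u s) w : R) => l.
  by field; rewrite gt_eqF.
move: hD hE; rewrite /entropy -AE; set X := expect _ _; set Y := A s * _.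
rewrite -subr_ge0 => h1; rewrite -subr_ge0 => h2; rewrite -subr_ge0.
apply: le_trans (addr_ge0 h1 h2) _.
by rewrite le_eqVlt; apply/orP; left; apply/eqP; ring.
Qed.

Lemma path_log_norm_le b : a <= b ->
  (forall s, a <= s -> s <= b -> q s < 1 /\ q s != 0) ->
  p^-1 * log_moment mu p (u a) <= (q b)^-1 * log_moment mu (q b) (u b).
Proof.
move=> ab hq.
have qa : q a = p by rewrite /q /exponent_path subrr mulr0 expR0 mulr1 subKr.
rewrite -{1 2}qa.
have A0 s : 0 < A s by exact: expect_expR_gt0.
pose N s := (q s)^-1 * ln (A s).
pose dN s := - (q s) ^- 2 * (kappa * (q s - 1)) * ln (A s)
  + (q s)^-1 * (dA s / A s).
apply: (@nondecreasing_of_is_derive _ N dN _ _ ab) => s as_ sb;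
  have [q1 q0] := hq s as_ sb.
  have dq := is_deriveV q0 (is_derive_exponent_path kappa a p s).
  have dA_s := is_derive_path_moment as_.
  exact: is_derive_fun_mul dq (is_derive_fun_ln (A0 s) dA_s).
have -> : dN s = (q s * dA s - kappa * (q s - 1) * (A s * ln (A s)))
    / (q s ^+ 2 * A s).
  by rewrite /dN; field; rewrite q0 gt_eqF.
rewrite divr_ge0 ?subr_ge0 ?path_entropy_production//.
by rewrite mulr_ge0 ?sqr_ge0// ltW.
Qed.

End Path.
End ReverseHypercontractivity.

(** * Comparison of norms at two times *)

Section Comparison.
Context {R : realType} {Omega : finType}.
Variables (mu : Omega -> R) (L : {linear (Omega -> R^o) -> (Omega -> R^o)}).
Hypotheses (hmu : prob_weights mu) (hL : generator mu L).
Variable K : R.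
Hypothesis K0 : 0 < K.
Hypothesis entropy_le : forall g, positive_fun g ->
  entropy mu g <= K * dirichlet mu L g (fun w => ln (g w)).
Variable f : Omega -> R.
Hypothesis f0 : positive_fun f.
Implicit Types a b p q : R.

Lemma ln_ratio_gt0 p q : q < p -> p < 1 -> 0 < ln ((1 - q) / (1 - p)).
Proof.
by move=> qp p1; apply: ln_gt0; rewrite ltr_pdivlMr ?subr_gt0// mul1r; lra.
Qed.

(** The speed [kappa] is chosen so that the path reaches [q] exactly at time
    [b]; this requires [kappa * K <= 1], which is the lower bound on [b - a].
    The times are arbitrary so that intervals can be joined without the
    composition law of the semigroup. *)
Lemma pnorm_semigroup_le_same_sign a b p q : 0 <= a -> q < p -> p < 1 ->
  0 < q \/ p < 0 -> K * ln ((1 - q) / (1 - p)) <= b - a ->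
  pnorm mu p (semigroup L a f) <= pnorm mu q (semigroup L b f).
Proof.
move=> a0 qp p1 pq0 hab; have l0 := ln_ratio_gt0 qp p1.
set l := ln _ in l0 hab.
have ab : 0 < b - a by apply: lt_le_trans hab; exact: mulr_gt0.
have leab : a <= b by rewrite -subr_ge0 ltW.
pose kappa := l / (b - a).
have kappa0 : 0 <= kappa by rewrite divr_ge0 ?ltW.
have kl : kappa * (b - a) = l by rewrite /kappa divfK// gt_eqF.
have hkappa g : positive_fun g ->
    kappa * entropy mu g <= dirichlet mu L g (fun w => ln (g w)).
  move=> g0.
  apply: (@le_trans _ _
    (kappa * (K * dirichlet mu L g (fun w => ln (g w))))).
    by rewrite ler_wpM2l ?entropy_le.
  rewrite mulrA -[leRHS]mul1r ler_wpM2r ?dirichlet_ln_ge0//.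
  by rewrite /kappa mulrAC ler_pdivrMr// mul1r mulrC.
have qb : exponent_path kappa a p b = q.
  rewrite /exponent_path kl lnK ?posrE ?divr_gt0 ?subr_gt0//; last exact: lt_trans p1.
  by field; rewrite subr_eq0 gt_eqF.
have hq s : a <= s -> s <= b ->
    exponent_path kappa a p s < 1 /\ exponent_path kappa a p s != 0.
  move=> as_ sb.
  have lo : q <= exponent_path kappa a p s.
    rewrite -qb /exponent_path lerB// ler_wpM2l ?subr_ge0 ?(ltW p1)//.
    by rewrite ler_expR ler_wpM2l// lerB.
  have hi : exponent_path kappa a p s <= p.
    rewrite /exponent_path lerBlDr -lerBlDl -[leLHS]mulr1.
    rewrite ler_wpM2l ?subr_ge0 ?(ltW p1)//.
    by rewrite -expR0 ler_expR mulr_ge0// subr_ge0.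
  split; first exact: le_lt_trans p1.
  case: pq0 => h; first by rewrite gt_eqF// (lt_le_trans h).
  by rewrite lt_eqF// (le_lt_trans hi).
have b0 : 0 <= b by exact: le_trans leab.
have pn0 : p != 0.
  by case: pq0 => h; [rewrite gt_eqF// (lt_trans h)|rewrite lt_eqF].
have qn0 : q != 0.
  by case: pq0 => h; [rewrite gt_eqF|rewrite lt_eqF// (lt_trans qp)].
have ua0 : positive_fun (semigroup L a f) by exact: (semigroup_gt0 hmu).
have ub0 : positive_fun (semigroup L b f) by exact: (semigroup_gt0 hmu).
rewrite (pnormE hmu ua0 pn0) (pnormE hmu ub0 qn0) ler_expR.
by have := path_log_norm_le hmu hL f0 a0 hkappa leab hq; rewrite qb.
Qed.

Lemma ln_ratio_le p q p' q' : q' < 1 -> p < 1 -> q <= q' -> p' <= p ->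
  p' < 1 -> ln ((1 - q') / (1 - p')) <= ln ((1 - q) / (1 - p)).
Proof.
move=> q'1 p1 qq' pp' p'1.
have q1 : q < 1 by exact: le_lt_trans q'1.
rewrite ler_ln ?posrE ?divr_gt0 ?subr_gt0//.
by apply: ler_pM; rewrite ?invr_ge0 ?lef_pV2 ?posrE ?subr_ge0 ?subr_gt0 ?lerB// ltW.
Qed.

(** The time [b] suffices to reach every exponent [e] in [(0, p)], so [e] can
    tend to 0 with both times fixed. *)
Lemma pnorm_semigroup_le_to0 a b p : 0 <= a -> 0 < p -> p < 1 ->
  K * ln ((1 - 0) / (1 - p)) <= b - a ->
  pnorm mu p (semigroup L a f) <= pnorm mu 0 (semigroup L b f).
Proof.
move=> a0 p0 p1 hab; have l0 := ln_ratio_gt0 p0 p1.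
have b0 : 0 <= b.
  apply: le_trans a0 _; rewrite -subr_ge0; apply: le_trans hab.
  by rewrite ltW// mulr_gt0.
have ub0 : positive_fun (semigroup L b f) by exact: (semigroup_gt0 hmu).
apply: (cvgr_to_ge (cvg_dnbhs_at_right (cvg_pnorm0 hmu ub0))).
near=> e; have e0 : 0 < e by near: e; exact: nbhs_right_gt.
have ep : e < p by near: e; exact: nbhs_right_lt.
apply: pnorm_semigroup_le_same_sign => //; first by left.
apply: le_trans hab; rewrite ler_pM2l// ln_ratio_le//; lra.
Unshelve. all: by end_near. Qed.

Lemma pnorm_semigroup_le_from0 a b q : 0 <= a -> q < 0 ->
  K * ln ((1 - q) / (1 - 0)) <= b - a ->
  pnorm mu 0 (semigroup L a f) <= pnorm mu q (semigroup L b f).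
Proof.
move=> a0 q0 hab.
have ua0 : positive_fun (semigroup L a f) by exact: (semigroup_gt0 hmu).
apply: (cvgr_to_le (cvg_dnbhs_at_left (cvg_pnorm0 hmu ua0))).
near=> e; have e0 : e < 0 by near: e; exact: nbhs_left_lt.
have qe : q < e by near: e; exact: nbhs_left_gt.
apply: pnorm_semigroup_le_same_sign => //; first exact: lt_trans ltr01.
  by right.
apply: le_trans hab; rewrite ler_pM2l// ln_ratio_le//; lra.
Unshelve. all: by end_near. Qed.

Lemma pnorm_semigroup_le a b p q : 0 <= a -> q < p -> p < 1 ->
  K * ln ((1 - q) / (1 - p)) <= b - a ->
  pnorm mu p (semigroup L a f) <= pnorm mu q (semigroup L b f).
Proof.
move=> a0 qp p1 hab.
have [q0|q0|q0] := ltrgtP q 0.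
- have [p0|p0|p0] := ltrgtP p 0.
  + by apply: pnorm_semigroup_le_same_sign => //; right.
  + (* The path crosses 0 at time c; the logarithms of the two ratios add up to
       the logarithm of (1 - q) / (1 - p). *)
    pose c := a + K * ln ((1 - 0) / (1 - p)).
    have c0 : 0 <= c by rewrite addr_ge0// ltW// mulr_gt0// ln_ratio_gt0.
    apply: (@le_trans _ _ (pnorm mu 0 (semigroup L c f))).
      by apply: pnorm_semigroup_le_to0; rewrite // /c addrAC subrr add0r.
    apply: pnorm_semigroup_le_from0 => //.
    move: hab; rewrite /c subr0 divr1 div1r.
    rewrite lnM ?posrE ?invr_gt0 ?subr_gt0//; last exact: lt_trans p1.
    rewrite mulrDr; lra.
  + by rewrite p0; apply: pnorm_semigroup_le_from0 => //; rewrite -p0.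
- by apply: pnorm_semigroup_le_same_sign => //; left.
- by rewrite q0; apply: pnorm_semigroup_le_to0; rewrite // -q0.
Qed.

End Comparison.

Theorem theorem1p10 (R : realType) (Omega : finType) (mu : Omega -> R)
  (hmu : prob_weights mu)
  (L : {linear (Omega -> R^o) -> (Omega -> R^o)}) (hL : generator mu L)
  (r C : R) (hr : 1 <= r) (hC : 0 < C) (hLS : logSob mu L r C)
  (p q : R) (hqp : q < p) (hp : p < 1)
  (f : Omega -> R) (hf : positive_fun f)
  (t : R) (ht : C / 4 * ln ((1 - q) / (1 - p)) <= t) :
  pnorm mu p f <= pnorm mu q (semigroup L t f).
Proof.
have entropy_le g : positive_fun g ->
    entropy mu g <= C / 4 * dirichlet mu L g (fun w => ln (g w)).
  exact: (logSob_entropy_le hmu hL hr hC hLS).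
have -> : pnorm mu p f = pnorm mu p (semigroup L 0 f).
  by congr (pnorm _ _ _); apply/funext => w; rewrite semigroup0.
apply: (pnorm_semigroup_le hmu hL _ entropy_le) => //; first by rewrite divr_gt0.
by rewrite subr0.
Qed.
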